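(* Let $N\ge 1$, $c\ge 1$, let $R(N)$ be the set of rank-based judged runs of length $N$ over relevance degrees $\mathcal{a}_0\prec\cdots\prec\mathcal{a}_c$, and let $\preceq$ be the replacement [rank-based] ordering on $R(N)$. Let $g$ be a gain function, $p\in(0,1)$ and $b>1$. Then the (graded) rank-biased precision $gRBP$ with parameter $p$ and the discounted cumulated gain $DCG_b$ are positive valuations on the lattice $(R(N),\wedge,\vee,\preceq)$. That is, for $M\in\{gRBP,DCG_b\}$: $M(\hat r)+M(\hat s)=M(\hat r\vee\hat s)+M(\hat r\wedge\hat s)$ for all $\hat r,\hat s\in R(N)$, and $\hat r\preceq\hat s$, $\hat r\ne\hat s$ imply $M(\hat r)<M(\hat s)$.
   Context: Relevance degrees: $REL=\{\mathcal{a}_0,\ldots,\mathcal{a}_c\}$ is a finite totally ordered set (order $\preccurlyeq$) with $\mathcal{a}_0\prec\mathcal{a}_1\prec\cdots\prec\mathcal{a}_c$. A gain function is a strictly increasing map $g:REL\to[0,\infty)$ with $g(\mathcal{a}_0)=0$. Rank-based judged runs: $R(N)=REL^N$ is the set of all ordered lists $\hat r=(\hat r[1],\ldots,\hat r[N])$ of $N$ elements of $REL$. Replacement [rank-based] ordering: $\hat r\preceq\hat s$ if and only if $\hat r[k]\preccurlyeq\hat s[k]$ for all $k\in\{1,\ldots,N\}$. With this order $R(N)$ is a distributive lattice; $\wedge$ and $\vee$ denote its meet and join. Graded rank-biased precision: $gRBP(\hat r)=\frac{1-p}{g(\mathcal{a}_c)}\sum_{i=1}^N p^{i-1}g(\hat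 r[i])$, where $p$ is the persistence parameter. Discounted cumulated gain: $DCG_b(\hat r)=\sum_{i=1}^N\frac{g(\hat r[i])}{\max\{1,\log_b i\}}$. *)

(* Defs.v *)
From HB Require Import structures.
From mathcomp Require Import all_boot all_order all_algebra.
From mathcomp Require Import reals exp.

Set Implicit Arguments.
Unset Strict Implicit.
Unset Printing Implicit Defensive.

Import Order.TTheory GRing.Theory Num.Theory.
Local Open Scope ring_scope.

Definition valuation (R : realType) (d : Order.disp_t) (L : latticeType d)
    (M : L -> R) : Prop :=
  forall r s : L, M r + M s = M (r `|` s)%O + M (r `&` s)%O.

Definition positive_valuation (R : realType) (d : Order.disp_t)
    (L : latticeType d) (M : L -> R) : Prop :=
  valuation M /\ (forall r s : L, (r <= s)%O -> r <> s -> M r < M s).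

(* [finTBOrderType] is the library's class of nonempty finite totally ordered
   sets; [\bot] and [\top] are its least and greatest relevance degrees a_0 and
   a_c. *)
Definition gain_function (R : realType) (d : Order.disp_t)
    (REL : finTBOrderType d) (g : REL -> R) : Prop :=
  [/\ forall a : REL, 0 <= g a,
      forall a a' : REL, (a < a')%O -> g a < g a'
    & g \bot%O = 0].

(* [N.-tupleprod REL] is the library's alias of [N.-tuple REL] that carries the
   componentwise order as a lattice: this is R(N) = REL^N under the replacement
   ordering, as the next lemma checks. *)
Lemma replacement_leE (d : Order.disp_t) (REL : finTBOrderType d) (N : nat)
    (r s : N.-tupleprod REL) :
  (r <= s)%O <-> (forall k : 'I_N, (tnth r k <= tnth s k)%O).
Proof. by rewrite leEtprod; split=> /forallP. Qed.

(* Positions are counted from 0: index [i : 'I_N] stands for rank i + 1, so the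
   weight p^(rank - 1) reads [p ^+ i]. *)
Definition gRBP (R : realType) (d : Order.disp_t) (REL : finTBOrderType d)
    (g : REL -> R) (p : R) (N : nat) (r : N.-tupleprod REL) : R :=
  (1 - p) / g \top%O * \sum_(i < N) p ^+ i * g (tnth r i).

Definition logb (R : realType) (b x : R) : R := ln x / ln b.

Definition DCG (R : realType) (d : Order.disp_t) (REL : finTBOrderType d)
    (g : REL -> R) (b : R) (N : nat) (r : N.-tupleprod REL) : R :=
  \sum_(i < N) g (tnth r i) / Num.max 1 (logb b (i.+1)%:R).

(* Main.v *)
Require Import Defs.
From mathcomp Require Import all_boot all_order all_algebra.
From mathcomp Require Import reals exp.
Import Order.TTheory GRing.Theory Num.Theory.
Local Open Scope ring_scope.

(** Both measures are sums over the ranks of a fixed positive weight times the gain at that rank,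
    and [weighted_gain_positive_valuation] treats all such sums at once. Modularity holds rank by
    rank because [REL] is a chain; strict monotonicity comes from strictly increasing gains and
    positive weights. For each measure it then remains to exhibit the weights and check their
    sign. *)

Lemma positive_valuation_eq (R : realType) (d : Order.disp_t)
    (L : latticeType d) (M M' : L -> R) :
  M' =1 M -> positive_valuation M -> positive_valuation M'.
Proof.
move=> eqM [valM ltM]; split=> [r s | r s]; rewrite !eqM; first exact: valM.
exact: ltM.
Qed.

(* REL is a chain, so at each rank {r k, s k} = {(r v s) k, (r ^ s) k}: any sum
   of functions of the single ranks is modular. *)
Lemma weighted_gain_positive_valuation (R : realType) (d : Order.disp_t)
    (REL : finTBOrderType d) (N : nat) (w : 'I_N -> R) (g : REL -> R) :
  (forall i, 0 < w i) -> (forall a a' : REL, (a < a')%O -> g a < g a') ->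
  positive_valuation
    (fun r : N.-tupleprod REL => \sum_(i < N) w i * g (tnth r i)).
Proof.
move=> w_gt0 g_lt; split=> [r s | r s le_rs neq_rs].
  rewrite -!big_split; apply: eq_bigr => i _ /=.
  rewrite tnth_join tnth_meet; case: (leP (tnth r i) (tnth s i)) => // _.
  by rewrite addrC.
have le_g k : g (tnth r k) <= g (tnth s k).
  have /replacement_leE/(_ k) := le_rs; rewrite le_eqVlt.
  by case/orP => [/eqP -> // | /g_lt/ltW].
have [k neq_k] : exists k, tnth r k != tnth s k.
  apply/existsP; apply: contra_notT neq_rs => /existsPn eq_rs.
  by apply: eq_from_tnth => k; apply/eqP; rewrite -[_ == _]negbK eq_rs.
(* The term at the differing rank [k] grows strictly, and by [le_g] no other term decreases. *)
rewrite (bigD1 k) //= [ltRHS](bigD1 k) //=; apply: ltr_leD.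
  rewrite ltr_pM2l //; apply: g_lt; rewrite lt_neqAle neq_k /=.
  by have /replacement_leE := le_rs.
by apply: ler_sum => i _; rewrite ler_pM2l.
Qed.

Theorem proposition6 (R : realType) (d : Order.disp_t)
    (REL : finTBOrderType d) (c : nat) (hc : (1 <= c)%N)
    (hREL : #|REL| = c.+1) (N : nat) (hN : (1 <= N)%N)
    (g : REL -> R) (hg : gain_function g)
    (p : R) (hp0 : 0 < p) (hp1 : p < 1) (b : R) (hb : 1 < b) :
  positive_valuation (fun r : N.-tupleprod REL => gRBP g p r) /\
  positive_valuation (fun r : N.-tupleprod REL => DCG g b r).
Proof.

have [g_ge0 g_lt g0] := hg.
have gtop_gt0 : 0 < g \top%O.
  (* If the least and greatest degrees coincided, [REL] would be a singleton, against
     [#|REL| = c.+1] with [1 <= c]. *)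
  rewrite -g0; apply: g_lt; rewrite lt_neqAle le0x andbT; apply/eqP => bot_top.
  have le_all (a a' : REL) : (a <= a')%O.
    by rewrite (le_trans (lex1 a)) // -bot_top le0x.
  have : (#|REL| <= 1)%N.
    by apply/card_le1_eqP => a a' _ _; apply: le_anti; rewrite !le_all.
  by rewrite hREL leqNgt ltnS hc.
split.
- apply: (@positive_valuation_eq _ _ _ (fun r : N.-tupleprod REL =>
    \sum_(i < N) (1 - p) / g \top%O * p ^+ i * g (tnth r i))).
    by move=> r; rewrite /gRBP mulr_sumr; apply: eq_bigr => i _; rewrite mulrA.
  apply: weighted_gain_positive_valuation g_lt => i.
  by rewrite mulr_gt0 ?exprn_gt0 ?divr_gt0 ?subr_gt0.
- apply: (@positive_valuation_eq _ _ _ (fun r : N.-tupleprod REL =>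
    \sum_(i < N) (Num.max 1 (logb b i.+1%:R))^-1 * g (tnth r i))).
    by move=> r; apply: eq_bigr => i _; rewrite mulrC.
  apply: weighted_gain_positive_valuation g_lt => i.
  (* The maximum with 1 alone makes the discount positive, even at rank 1, where the logarithm is
     0. *)
  by rewrite invr_gt0 lt_max ltr01.
Qed.
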